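(* Let $f\in\mathcal{A}_p$ and suppose that $\alpha_a$ is independent of $a$. Let $\phi_i$ ($i=1,2$) be analytic in $\mathbb{U}$ with $\phi_i(0)=1$ and let $$F(z):=\frac{\alpha_a}{z^{\alpha_a-p}}\int_0^zt^{\alpha_a-p-1}f(t)\,dt.$$ Then $$\phi_1(z)\prec\Omega_{L,\mu,\nu}^{a}(f(z))\prec\phi_2(z)$$ if and only if $$\phi_1(z)\prec\Omega_{L,\mu,\nu}^{a+1}(F(z))\prec\phi_2(z).$$
   Context: $\mathbb{U}=\{z\in\mathbb{C}:|z|<1\}$; $p\ge 1$ is an integer; $\mathcal{A}_p$ is the class of functions analytic in $\mathbb{U}$ of the form $f(z)=z^p+\sum_{k=p+1}^\infty a_kz^k$; the convolution of $f$ and $g(z)=z^p+\sum_{k\ge p+1} b_kz^k$ is $(f*g)(z)=z^p+\sum_{k\ge p+1}a_kb_kz^k$. For analytic $g,h$ in $\mathbb{U}$, $g\prec h$ means $g(z)=h(w(z))$ for some analytic $w$ in $\mathbb{U}$ with $|w(z)|\le|z|$. Operators: $(L_p^a)$ is a family of linear operators on $\mathcal{A}_p$, of convolution form $L_p^af=\mathscr{L}_a*f$ with $\mathscr{L}_a\in\mathcal{A}_p$, indexed by a parameter $a$ (with shifts $a+1,a+2$ allowed), with complex constants $\alpha_a$ such that for all $f\in\mathcal{A}_p$ $$z[L_p^af(z)]'=\alpha_aL_p^{a+1}f(z)-(\alpha_a-p)L_p^af(z).$$ For real $\mu,\nu$ not both zero, $$\Omega_{L,\mu,\nu}^a(f(z))=\left(\frac{L_p^{a+1}f(z)}{z^p}\right)^\mu\left(\frac{z^p}{L_p^af(z)}\right)^\nu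 .$$ Powers are principal ones (branches with value $1$ at $z=0$). It is understood that $L_p^{a+1}f(z)/z^p$ has no zeros in $\mathbb{U}$ if $\mu\notin\{0,1,2,\dots\}$ and $L_p^{a}f(z)/z^p$ has no zeros in $\mathbb{U}$ if $-\nu\notin\{0,1,2,\dots\}$, and likewise for $F$ with $a$ replaced by $a+1$. It is also understood that $\alpha_a$ is such that the integral defining $F$ converges ($\mathrm{Re}\,\alpha_a>0$), so $F(z)=z^p+\sum_{n\ge p+1}\frac{\alpha_a}{\alpha_a+n-p}a_nz^n\in\mathcal{A}_p$. *)

(* Defs.v *)
From Stdlib Require Import Reals ClassicalEpsilon.
From Coquelicot Require Import Coquelicot.

Open Scope C_scope.

Definition disc (z : C) : Prop := (Cmod z < 1)%R.

Definition analytic (f : C -> C) : Prop :=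
  forall z, disc z -> ex_derive (K := C_AbsRing) (V := C_NormedModule) f z.

Definition expansion (a : nat -> C) (f : C -> C) : Prop :=
  forall z, disc z -> is_pseries (K := C_AbsRing) (V := C_NormedModule) a z (f z).

Definition class_A (p : nat) (f : C -> C) : Prop :=
  analytic f /\
  exists a : nat -> C,
    (forall k, (k < p)%nat -> a k = 0) /\ a p = 1 /\ expansion a f.

(* [h = f * g] on the disc; for [f, g] in [class_A p] the coefficients below
   index [p] vanish and the one of index [p] is 1, as in the usual formula. *)
Definition is_convolution (f g h : C -> C) : Prop :=
  exists a b : nat -> C,
    expansion a f /\ expansion b g /\ expansion (fun k => a k * b k) h.

Definition subordinate (g h : C -> C) : Prop :=
  exists w : C -> C,
    analytic w /\
    (forall z, disc z -> (Cmod (w z) <= Cmod z)%R) /\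
    (forall z, disc z -> g z = h (w z)).

(* The parameter ranges over a set [D]; the recurrence is required whenever
   both parameters occurring in it are admissible. *)
Record operator_family (p : nat) (D : C -> Prop)
    (L : C -> (C -> C) -> (C -> C)) (alpha : C -> C) : Prop := {
  operator_maps : forall a f, D a -> class_A p f -> class_A p (L a f);
  operator_convolution : forall a, D a ->
    exists l, class_A p l /\
      forall f, class_A p f -> is_convolution l f (L a f);
  operator_recurrence : forall a f z, D a -> D (a + 1) -> class_A p f -> disc z ->
    z * C_derive (L a f) z
    = alpha a * L (a + 1) f z - (alpha a - RtoC (INR p)) * L a f z
}.

Definition Cexp (z : C) : C :=
  (exp (Re z) * cos (Im z), exp (Re z) * sin (Im z))%R.

(* Principal argument, in (-PI, PI]. *)
Definition Carg (z : C) : R :=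
  if Rle_dec 0 (Im z) then acos (Re z / Cmod z)
  else Ropp (acos (Re z / Cmod z)).

Definition Clog (z : C) : C := (ln (Cmod z), Carg z).

Definition Cpower (z c : C) : C := Cexp (c * Clog z).

Definition is_nat (x : R) : Prop := exists n : nat, x = INR n.

(* [h] is [g ^ mu] on the disc.  The second clause is the branch
   [exp (mu * log g)] with [log g] analytic and [log g (0) = 0], available when
   [g 0 = 1] and [g] has no zeros; the first one is the ordinary power, for
   which zeros are allowed.  Where both apply they agree. *)
Definition is_power (g : C -> C) (mu : R) (h : C -> C) : Prop :=
  (exists n : nat, mu = INR n /\ forall z, disc z -> h z = Cpow (g z) n) \/
  (exists l : C -> C, analytic l /\ l 0 = 0 /\
     forall z, disc z -> Cexp (l z) = g z /\ h z = Cexp (RtoC mu * l z)).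

Definition power (g : C -> C) (mu : R) : C -> C :=
  epsilon (inhabits g) (is_power g mu).

(* [g z / z ^ p], with the singularity at 0 removed: the limit there is 1 for
   [g] in [class_A p]. *)
Definition quot (p : nat) (g : C -> C) (z : C) : C :=
  if Ceq_dec z 0 then 1 else g z / Cpow z p.

(* The factor [(z ^ p / L a f) ^ nu] is read as [(L a f / z ^ p) ^ (- nu)],
   which also makes sense at the zeros of [L a f] when [- nu] is a natural
   number. *)
Definition Omega (p : nat) (L : C -> (C -> C) -> (C -> C)) (mu nu : R) (a : C)
    (f : C -> C) (z : C) : C :=
  power (quot p (L (a + 1) f)) mu z * power (quot p (L a f)) (- nu)%R z.

Definition zero_free (g : C -> C) : Prop := forall z, disc z -> g z <> 0.

Definition Omega_admissible (p : nat) (L : C -> (C -> C) -> (C -> C))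
    (mu nu : R) (a : C) (f : C -> C) : Prop :=
  (~ is_nat mu -> zero_free (quot p (L (a + 1) f))) /\
  (~ is_nat (- nu)%R -> zero_free (quot p (L a f))).

(* [c / z^(c-p) * int_0^z t^(c-p-1) f(t) dt] along the segment [t = s z],
   [0 < s <= 1], improper at 0.  The argument is constant on that segment, so
   both powers use the same branch of the logarithm and the value does not
   depend on it.  At [z = 0] the integrand vanishes and the value is 0. *)
Definition integral_operator (p : nat) (c : C) (f : C -> C) (z : C) : C :=
  c / Cpower z (c - RtoC (INR p)) *
  RInt_gen (V := C_R_CompleteNormedModule)
    (fun s : R =>
       Cpower (RtoC s * z) (c - RtoC (INR p) - 1) * f (RtoC s * z) * z)
    (at_right 0%R) (at_point 1%R).

(* Main.v *)
(** The operators act on Taylor coefficients.  Let [b] and [b1] be the coefficient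
    sequences of the convolution kernels of [L a] and [L (a + 1)].  Comparing
    coefficients in the recurrence gives
    [(alpha + n - p) b n A n = alpha (b1 n) A n] for every [f] in the class, [A]
    being its coefficients, while [F] has coefficients
    [alpha / (alpha + n - p) A n].  Hence [L (a + 1) F = L a f], and since [alpha]
    does not depend on [a] also [L (a + 2) F = L (a + 1) f]: the two functions
    [Omega] coincide.  The coefficients of [F] come from differentiating
    [s ^ alpha * k (s z)] in [s], where [f = z ^ p h], [h = sum c n z ^ n] and
    [k = sum c n / (alpha + n) z ^ n]. *)

From Stdlib Require Import Reals Lra Lia.
From Stdlib Require Import ClassicalEpsilon FunctionalExtensionality PropExtensionality.
From Coquelicot Require Import Coquelicot.
Require Import Defs.
Open Scope C_scope.

(* [ring] recognizes an equality in [C] or [R] only when its type is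
   syntactically that one, not the carrier of a Coquelicot structure. *)
Ltac eq_in T := match goal with |- @eq _ ?a ?b => change (@eq T a b) end.

(** * Complex power series and their radius of convergence *)

Lemma is_pseries_C_unique (c : nat -> C) (z l1 l2 : C) :
  is_pseries (K := C_AbsRing) (V := C_NormedModule) c z l1 ->
  is_pseries (K := C_AbsRing) (V := C_NormedModule) c z l2 -> l1 = l2.
Proof.
intros H1 H2.
exact (filterlim_locally_unique (K := C_AbsRing) (V := C_NormedModule) _ _ _ H1 H2).
Qed.

(** Apart from the first, each term is a difference of two consecutive partial sums, and convergent
    partial sums are bounded. *)
Lemma series_terms_bounded (u : nat -> C) (l : C) :
  is_series (K := C_AbsRing) (V := C_NormedModule) u l ->
  exists M, forall n, (Cmod (u n) <= M)%R.
Proof.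
intros H.
destruct (filterlim_bounded (K := C_AbsRing) (V := C_NormedModule) (sum_n u))
  as [M HM]; [now exists l|].
assert (HM' : forall k, (Cmod (sum_n u k) <= M)%R).
{ intro k. exact (HM k). }
exists (M + M)%R. intros n.
destruct n as [|n].
- specialize (HM' 0%nat). rewrite sum_O in HM'.
  pose proof (Cmod_ge_0 (u 0%nat)); lra.
- replace (u (S n)) with (sum_n u (S n) + - sum_n u n).
  + eapply Rle_trans; [apply Cmod_triangle|]. rewrite Cmod_opp.
    apply Rplus_le_compat; apply HM'.
  + rewrite sum_Sn. unfold plus; simpl. ring.
Qed.

Lemma is_series_Cmod_le (u : nat -> C) (v : nat -> R) (l : C) :
  is_series (K := C_AbsRing) (V := C_NormedModule) u l ->
  (forall n, (Cmod (u n) <= v n)%R) -> ex_series v ->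
  (Cmod l <= Series v)%R.
Proof.
intros Hu Huv Hv.
apply (filterlim_le (F := eventually) (fun N => Cmod (sum_n u N)) (sum_n v)
  (Cmod l) (Series v)).
- apply filter_forall. intro N.
  eapply Rle_trans;
    [exact (norm_sum_n_m (K := C_AbsRing) (V := C_NormedModule) u 0 N)|].
  apply sum_n_m_le; exact Huv.
- apply (filterlim_comp _ _ _ (sum_n u) (norm : C_NormedModule -> R)
    eventually (locally (T := C_NormedModule) l)); [exact Hu|].
  exact (filterlim_norm (K := C_AbsRing) (V := C_NormedModule) l).
- exact (Series_correct v Hv).
Qed.

(** Passing to moduli makes the real theory of [CV_radius] available for complex coefficients. *)
Definition radius_ge_1 (c : nat -> C) : Prop :=
  Rbar_le 1 (CV_radius (fun n => Cmod (c n))).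

Lemma radius_ge_1_bounded (c : nat -> C) :
  (forall r, (0 <= r < 1)%R -> exists M, forall n, (Cmod (c n) * r ^ n <= M)%R) ->
  radius_ge_1 c.
Proof.
intros H. unfold radius_ge_1.
destruct (CV_radius_bounded (fun n => Cmod (c n))) as [Hub _].
pose proof (CV_radius_ge_0 (fun n => Cmod (c n))) as H0.
destruct (CV_radius (fun n => Cmod (c n))) as [x| |]; simpl in *; try easy.
apply Rnot_lt_le; intro Hx.
(* If the radius [x] were below 1, the terms would still be bounded at the midpoint of [x] and 1,
   which lies beyond the radius. *)
assert (Hr : (0 <= (x + 1) / 2 < 1)%R) by lra.
specialize (Hub ((x + 1) / 2)%R). simpl in Hub.
enough ((x + 1) / 2 <= x)%R by lra.
apply Hub. destruct (H _ Hr) as [M HM]. exists M. intro n.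
rewrite Rabs_pos_eq; [apply HM|].
apply Rmult_le_pos; [apply Cmod_ge_0 | apply pow_le; lra].
Qed.

Lemma radius_ge_1_ex_series (c : nat -> C) (r : R) :
  radius_ge_1 c -> (0 <= r < 1)%R -> ex_series (fun n => Cmod (c n) * r ^ n)%R.
Proof.
intros H Hr.
apply (ex_series_ext (fun n => Rabs (Cmod (c n) * r ^ n))).
- intro n. apply Rabs_pos_eq, Rmult_le_pos; [apply Cmod_ge_0 | apply pow_le; lra].
- apply (CV_disk_inside (fun n => Cmod (c n))).
  apply (Rbar_lt_le_trans _ 1 _); [|exact H]. rewrite Rabs_pos_eq; simpl; lra.
Qed.

Lemma radius_ge_1_le (c d : nat -> C) (K : R) :
  (forall n, (Cmod (d n) <= K * Cmod (c n))%R) -> radius_ge_1 c -> radius_ge_1 d.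
Proof.
intros Hle H. apply radius_ge_1_bounded. intros r Hr.
destruct (filterlim_bounded (K := R_AbsRing) (V := R_NormedModule)
  (fun n => Cmod (c n) * r ^ n)%R) as [M HM].
{ exists 0%R. exact (ex_series_lim_0 _ (radius_ge_1_ex_series c r H Hr)). }
assert (HM' : forall n, (Cmod (c n) * r ^ n <= M)%R).
{ intro n. eapply Rle_trans; [apply Rle_abs | apply HM]. }
exists (Rabs K * M)%R. intro n.
assert (Hp : (0 <= r ^ n)%R) by (apply pow_le; lra).
apply Rle_trans with (Rabs K * (Cmod (c n) * r ^ n))%R.
- rewrite <- Rmult_assoc. apply Rmult_le_compat_r; [exact Hp|].
  eapply Rle_trans; [apply Hle|].
  apply Rmult_le_compat_r; [apply Cmod_ge_0 | apply Rle_abs].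
- apply Rmult_le_compat_l; [apply Rabs_pos | apply HM'].
Qed.

Definition coeff_derive (c : nat -> C) (n : nat) : C := RtoC (INR (S n)) * c (S n).

Lemma radius_ge_1_derive (c : nat -> C) :
  radius_ge_1 c -> radius_ge_1 (coeff_derive c).
Proof.
unfold radius_ge_1; intro H.
rewrite (CV_radius_ext _ (PS_derive (fun n => Cmod (c n)))).
- rewrite CV_radius_derive; exact H.
- intro n. unfold coeff_derive, PS_derive.
  rewrite Cmod_mult, Cmod_R, Rabs_pos_eq; [reflexivity | apply pos_INR].
Qed.

Lemma radius_ge_1_shift (c : nat -> C) (p : nat) :
  radius_ge_1 c -> radius_ge_1 (fun n => c (n + p)%nat).
Proof.
intro H; induction p as [|p IH].
- revert H. apply (radius_ge_1_le _ _ 1). intro n.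
  rewrite Nat.add_0_r. lra.
- unfold radius_ge_1 in *.
  rewrite <- (CV_radius_decr_1 (fun n => Cmod (c (n + p)%nat))) in IH.
  rewrite (CV_radius_ext _ (PS_decr_1 (fun n => Cmod (c (n + p)%nat)))).
  + exact IH.
  + intro n. unfold PS_decr_1. f_equal. f_equal. lia.
Qed.

(** Convergence at the real points of [0, 1) already bounds the terms, as [radius_ge_1_bounded]
    requires. *)
Lemma expansion_radius (c : nat -> C) (f : C -> C) :
  expansion c f -> radius_ge_1 c.
Proof.
intro H. apply radius_ge_1_bounded. intros r Hr.
assert (Hd : disc (RtoC r)).
{ unfold disc. rewrite Cmod_R, Rabs_pos_eq; lra. }
destruct (series_terms_bounded _ _ (H _ Hd))
  as [M HM].
exists M. intro n. specialize (HM n).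
change (Cmod (RtoC r ^ n * c n) <= M)%R in HM.
rewrite Cmod_mult, Cmod_pow, Cmod_R, Rabs_pos_eq in HM by lra. lra.
Qed.

(** Absolute convergence gives a limit at each point of the disc; [epsilon] gathers these limits
    into one function. *)
Lemma radius_expansion (c : nat -> C) :
  radius_ge_1 c -> exists f, expansion c f.
Proof.
intro H.
exists (fun z => epsilon (inhabits (RtoC 0))
  (is_pseries (K := C_AbsRing) (V := C_NormedModule) c z)).
intros z Hz. apply epsilon_spec.
destruct (ex_series_le (K := C_AbsRing) (V := C_CompleteNormedModule)
  (fun n => z ^ n * c n) (fun n => Cmod (c n) * Cmod z ^ n)%R) as [l Hl].
- intro n. change (Cmod (z ^ n * c n) <= Cmod (c n) * Cmod z ^ n)%R.
  rewrite Cmod_mult, Cmod_pow. lra.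
- apply radius_ge_1_ex_series; [exact H|].
  split; [apply Cmod_ge_0 | exact Hz].
- exists l. exact Hl.
Qed.

(** Induction through D (n+1) = w D n + (n+1) z^n (w-z)^2. At n = 0 the truncated [pred n] is
    harmless because the factor [INR n] vanishes. *)
Lemma pow_taylor2 (w z : C) (rho : R) (n : nat) :
  (Cmod w <= rho)%R -> (Cmod z <= rho)%R ->
  (Cmod (w ^ S n - z ^ S n - RtoC (INR (S n)) * z ^ n * (w - z))
   <= INR n * INR (S n) * rho ^ pred n * Cmod (w - z) ^ 2)%R.
Proof.
intros Hw Hz.
assert (Hr : (0 <= rho)%R) by (pose proof (Cmod_ge_0 w); lra).
pose (D := fun m => w ^ S m - z ^ S m - RtoC (INR (S m)) * z ^ m * (w - z)).
change (Cmod (D n) <= INR n * INR (S n) * rho ^ pred n * Cmod (w - z) ^ 2)%R.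
assert (Hq : (0 <= Cmod (w - z) ^ 2)%R) by apply pow2_ge_0.
induction n as [|n IH].
{ replace (D 0%nat) with (RtoC 0) by (unfold D; simpl; ring).
  rewrite Cmod_0. simpl; lra. }
assert (Hmod :
  (Cmod (D (S n)) <= rho * Cmod (D n) + INR (S n) * rho ^ n * Cmod (w - z) ^ 2)%R).
{ replace (D (S n))
    with (w * D n + RtoC (INR (S n)) * z ^ n * ((w - z) * (w - z)))
    by (unfold D; rewrite (S_INR (S n)), RtoC_plus; simpl Cpow; ring).
  eapply Rle_trans; [apply Cmod_triangle|].
  rewrite !Cmod_mult, Cmod_R, Cmod_pow, (Rabs_pos_eq (INR (S n)))
    by apply pos_INR.
  apply Rplus_le_compat.
  - apply Rmult_le_compat_r; [apply Cmod_ge_0 | exact Hw].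
  - replace (Cmod (w - z) ^ 2)%R with (Cmod (w - z) * Cmod (w - z))%R by ring.
    apply Rmult_le_compat_r; [apply Rmult_le_pos; apply Cmod_ge_0|].
    apply Rmult_le_compat_l; [apply pos_INR|].
    apply pow_incr. split; [apply Cmod_ge_0 | exact Hz]. }
eapply Rle_trans; [exact Hmod|].
assert (H1 := Rmult_le_compat_l rho _ _ Hr IH).
assert (Hp : (0 <= rho ^ n * Cmod (w - z) ^ 2)%R)
  by (apply Rmult_le_pos; [apply pow_le|]; assumption).
destruct n as [|n].
- simpl in *. lra.
- rewrite !S_INR in *. pose proof (pos_INR n).
  simpl (rho ^ S n)%R in *. simpl pred in *. simpl (rho ^ S n)%R. nra.
Qed.

(** * Termwise differentiation *)

(** Stated over any [AbsRing], so that it serves both the complex derivative and the real derivative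
    along a ray. *)
Lemma is_derive_quadratic (K : AbsRing) (V : NormedModule K) (f : K -> V)
    (x : K) (l : V) (M : R) :
  locally x (fun y => (norm (minus (minus (f y) (f x)) (scal (minus y x) l))
                       <= M * abs (minus y x) ^ 2)%R) ->
  is_derive f x l.
Proof.
intro H. split; [apply is_linear_scal_l|].
intros x' Hx' eps.
assert (E : x = x') by exact (is_filter_lim_locally_unique (V := AbsRing_NormedModule K) x x' Hx').
subst x'. clear Hx'.
(* Within this distance M |y-x|^2 is at most eps |y-x|; the added 1 keeps the denominator
   positive. *)
assert (Hd : (0 < eps / (Rabs M + 1))%R).
{ apply Rdiv_lt_0_compat; [apply cond_pos|]. pose proof (Rabs_pos M); lra. }
assert (Hb : locally x (fun y => (abs (minus y x) < eps / (Rabs M + 1))%R)).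
{ exists (mkposreal _ Hd). intros y Hy. exact Hy. }
generalize (filter_and _ _ H Hb). apply filter_imp. intros y [H1 H2].
eapply Rle_trans; [exact H1|].
change (norm (minus y x)) with (abs (minus y x)).
pose proof (abs_ge_0 (minus y x)) as H0.
apply Rlt_div_r in H2; [|pose proof (Rabs_pos M); lra].
pose proof (Rle_abs M). simpl. rewrite Rmult_1_r, <- Rmult_assoc.
apply Rmult_le_compat_r; [exact H0|]. pose proof (cond_pos eps). nra.
Qed.

(** The remainders of [pow_taylor2] are summed against the coefficients. The constant [M] is uniform
    in both points, so one estimate yields derivatives along complex and along real increments. *)
Lemma expansion_taylor2 (c : nat -> C) (f g : C -> C) (rho : R) :
  expansion c f -> expansion (coeff_derive c) g -> (rho < 1)%R ->
  exists M, forall w z, (Cmod w <= rho)%R -> (Cmod z <= rho)%R ->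
    (Cmod (f w - f z - (w - z) * g z) <= M * Cmod (w - z) ^ 2)%R.
Proof.
intros Hf Hg Hr.
destruct (Rlt_or_le rho 0) as [Hneg|Hpos].
{ exists 0%R. intros w z Hw. pose proof (Cmod_ge_0 w). lra. }
pose (v := fun n => (INR n * INR (S n) * rho ^ pred n * Cmod (c (S n)))%R).
(* Shifted by one, [v] is the series of moduli for the second derivative at [rho], and
   differentiation keeps the radius. *)
assert (Hv : ex_series v).
{ apply ex_series_incr_1.
  apply (ex_series_ext (fun n => Cmod (coeff_derive (coeff_derive c) n) * rho ^ n)%R).
  - intro n. unfold v, coeff_derive.
    rewrite !Cmod_mult, !Cmod_R, !(Rabs_pos_eq (INR _)) by apply pos_INR.
    simpl pred. eq_in R. ring.
  - apply radius_ge_1_ex_series; [|lra].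
    apply radius_ge_1_derive, (expansion_radius _ _ Hg). }
exists (Series v). intros w z Hw Hz.
assert (dw : disc w) by (unfold disc; lra).
assert (dz : disc z) by (unfold disc; lra).
assert (incr : forall x, disc x ->
  is_series (K := C_AbsRing) (V := C_NormedModule)
    (fun n => x ^ S n * c (S n)) (f x - c 0%nat)).
{ intros x Hx.
  apply (is_series_incr_1 (K := C_AbsRing) (V := C_NormedModule)
    (fun n => x ^ n * c n)).
  replace (plus _ _) with (f x); [exact (Hf x Hx)|].
  unfold plus; simpl. eq_in C. ring. }
(* The constant coefficient cancels, so the remainder is a series whose terms have the form treated
   by [pow_taylor2]. *)
assert (S1 := is_series_minus _ _ _ _ (is_series_minus _ _ _ _ (incr w dw) (incr z dz))
  (is_series_scal (K := C_AbsRing) (V := C_NormedModule) (w - z) _ _ (Hg z dz))).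
rewrite Rmult_comm, <- (Series_scal_l _ v).
eapply is_series_Cmod_le; [| |exact (ex_series_scal_l _ _ Hv)].
- replace (f w - f z - (w - z) * g z) with
    (f w - c 0%nat - (f z - c 0%nat) - (w - z) * g z) by ring.
  exact S1.
- intro n.
  change (Cmod (w ^ S n * c (S n) - z ^ S n * c (S n)
    - (w - z) * (z ^ n * (RtoC (INR (S n)) * c (S n)))) <= Cmod (w - z) ^ 2 * v n)%R.
  replace (_ - _) with
    ((w ^ S n - z ^ S n - RtoC (INR (S n)) * z ^ n * (w - z)) * c (S n)) by ring.
  rewrite Cmod_mult. unfold v.
  eapply Rle_trans;
    [apply Rmult_le_compat_r; [apply Cmod_ge_0 | exact (pow_taylor2 w z rho n Hw Hz)]|].
  right; ring.
Qed.

Lemma expansion_is_derive (c : nat -> C) (f g : C -> C) (z : C) :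
  expansion c f -> expansion (coeff_derive c) g -> disc z ->
  is_derive (K := C_AbsRing) (V := C_NormedModule) f z (g z).
Proof.
intros Hf Hg Hz. unfold disc in Hz.
(* This radius lies midway between |z| and 1, which leaves room for a neighbourhood of [z]. *)
destruct (expansion_taylor2 c f g ((Cmod z + 1) / 2) Hf Hg) as [M HM]; [lra|].
apply is_derive_quadratic with M.
assert (He : (0 < (1 - Cmod z) / 2)%R) by lra.
exists (mkposreal _ He). intros w Hw. change (Cmod (w - z) < (1 - Cmod z) / 2)%R in Hw.
apply HM; [|lra].
replace w with (z + (w - z)) by ring.
pose proof (Cmod_triangle z (w - z)). lra.
Qed.

Lemma expansion_is_derive_ray (c : nat -> C) (f g : C -> C) (z : C) (s : R) :
  expansion c f -> expansion (coeff_derive c) g -> disc (RtoC s * z) ->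
  is_derive (K := R_AbsRing) (V := C_R_NormedModule)
    (fun t => f (RtoC t * z)) s (z * g (RtoC s * z)).
Proof.
intros Hf Hg Hz. unfold disc in Hz.
destruct (expansion_taylor2 c f g ((Cmod (RtoC s * z) + 1) / 2) Hf Hg) as [M HM]; [lra|].
apply is_derive_quadratic with (M * Cmod z ^ 2)%R.
assert (Hp : (0 < Cmod z + 1)%R) by (pose proof (Cmod_ge_0 z); lra).
(* An increment of [t] moves the point [t z] by |z| times as much; dividing by |z| + 1 also covers z
   = 0. *)
assert (He : (0 < (1 - Cmod (RtoC s * z)) / 2 / (Cmod z + 1))%R).
{ apply Rdiv_lt_0_compat; lra. }
exists (mkposreal _ He). intros t Ht.
change (Rabs (t - s) < (1 - Cmod (RtoC s * z)) / 2 / (Cmod z + 1))%R in Ht.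
apply Rlt_div_r in Ht; [|exact Hp].
assert (E : RtoC t * z - RtoC s * z = RtoC (t - s) * z)
  by (rewrite RtoC_minus; ring).
assert (Em : Cmod (RtoC t * z - RtoC s * z) = (Rabs (t - s) * Cmod z)%R)
  by (rewrite E, Cmod_mult, Cmod_R; reflexivity).
change (abs (minus t s)) with (Rabs (t - s)).
replace (M * Cmod z ^ 2 * Rabs (t - s) ^ 2)%R
  with (M * Cmod (RtoC t * z - RtoC s * z) ^ 2)%R by (rewrite Em; ring).
rewrite <- Cmod_norm.
match goal with |- (Cmod ?u <= _)%R => replace u with
  (f (RtoC t * z) - f (RtoC s * z) - (RtoC t * z - RtoC s * z) * g (RtoC s * z)) end.
- apply HM; [|lra].
  replace (RtoC t * z) with (RtoC s * z + (RtoC t * z - RtoC s * z)) by ring.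
  eapply Rle_trans; [apply Cmod_triangle|]. rewrite Em.
  pose proof (Rabs_pos (t - s)). nra.
- rewrite E, scal_R_Cmult. change (minus t s) with (t - s)%R.
  transitivity (f (RtoC t * z) - f (RtoC s * z)
    - RtoC (t - s) * (z * g (RtoC s * z))); [ring | reflexivity].
Qed.

Lemma expansion_derive_exists (c : nat -> C) (f : C -> C) :
  expansion c f -> exists g, expansion (coeff_derive c) g.
Proof.
intro H. apply radius_expansion, radius_ge_1_derive, (expansion_radius _ _ H).
Qed.

Lemma expansion_analytic (c : nat -> C) (f : C -> C) :
  expansion c f -> analytic f.
Proof.
intros H z Hz. destruct (expansion_derive_exists c f H) as [g Hg].
exists (g z). exact (expansion_is_derive c f g z H Hg Hz).
Qed.

Lemma expansion_C_derive (c : nat -> C) (f : C -> C) :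
  expansion c f -> expansion (coeff_derive c) (C_derive f).
Proof.
intros H z Hz. destruct (expansion_derive_exists c f H) as [g Hg].
rewrite (is_C_derive_unique _ _ _ (expansion_is_derive c f g z H Hg Hz)).
exact (Hg z Hz).
Qed.

(** * Operations on expansions and uniqueness of coefficients *)

Lemma expansion_ext (a b : nat -> C) (f g : C -> C) :
  (forall n, a n = b n) -> (forall z, disc z -> f z = g z) ->
  expansion a f -> expansion b g.
Proof.
intros Hab Hfg H z Hz. rewrite <- (Hfg z Hz).
exact (is_pseries_ext _ _ _ _ Hab (H z Hz)).
Qed.

Lemma expansion_scal (k : C) (a : nat -> C) (f : C -> C) :
  expansion a f -> expansion (fun n => k * a n) (fun z => k * f z).
Proof.
intros H z Hz.
exact (is_pseries_scal (K := C_AbsRing) (V := C_NormedModule) k a z (f z)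
  (Cmult_comm z k) (H z Hz)).
Qed.

Lemma expansion_plus (a b : nat -> C) (f g : C -> C) :
  expansion a f -> expansion b g ->
  expansion (fun n => a n + b n) (fun z => f z + g z).
Proof.
intros Hf Hg z Hz.
exact (is_pseries_plus (K := C_AbsRing) (V := C_NormedModule) a b z _ _
  (Hf z Hz) (Hg z Hz)).
Qed.

(** The Euler operator is diagonal on coefficients, which turns the recurrence into a separate
    equation for each index. *)
Lemma expansion_euler (c : nat -> C) (f : C -> C) :
  expansion c f -> expansion (fun n => RtoC (INR n) * c n) (fun z => z * C_derive f z).
Proof.
intros H z Hz.
apply (is_pseries_ext (K := C_AbsRing) (V := C_NormedModule)
  (PS_incr_1 (V := C_NormedModule) (coeff_derive c))).
- intros [|n]; [|reflexivity]. unfold PS_incr_1. simpl. symmetry. apply Cmult_0_l.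
- exact (is_pseries_incr_1 (K := C_AbsRing) (V := C_NormedModule) _ _ _
    (expansion_C_derive c f H z Hz)).
Qed.

Lemma disc_0 : disc 0.
Proof. unfold disc. rewrite Cmod_0. lra. Qed.

Lemma disc_ball (z : C) : disc z -> exists eps : posreal,
  forall w, (Cmod (w - z) < eps)%R -> disc w.
Proof.
intro Hz. unfold disc in *.
assert (He : (0 < 1 - Cmod z)%R) by lra.
exists (mkposreal _ He). intros w Hw. simpl in Hw.
replace w with (z + (w - z)) by ring.
pose proof (Cmod_triangle z (w - z)). lra.
Qed.

(** The coefficient of index 0 is the value at 0. For the others, the derivative also vanishes on
    the disc, and its coefficient of index n is (n+1) c (n+1); hence the induction over all [c] and
    [f]. *)
Lemma expansion_zero (c : nat -> C) (f : C -> C) (n : nat) :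
  expansion c f -> (forall z, disc z -> f z = 0) -> c n = 0.
Proof.
revert c f. induction n as [|n IH]; intros c f Hf H0.
- rewrite <- (H0 0 disc_0).
  exact (is_pseries_C_unique c 0 _ _
    (is_pseries_0 (K := C_AbsRing) (V := C_NormedModule) c) (Hf 0 disc_0)).
- assert (E : coeff_derive c n = 0).
  { apply (IH _ _ (expansion_C_derive c f Hf)). intros z Hz.
    apply is_C_derive_unique.
    apply (is_derive_ext_loc (K := C_AbsRing) (V := C_NormedModule) (fun _ => RtoC 0)).
    - destruct (disc_ball z Hz) as [eps He]. exists eps. intros w Hw.
      symmetry. apply H0, He. exact Hw.
    - apply (is_derive_const (K := C_AbsRing) (V := C_NormedModule)). }
  unfold coeff_derive in E.
  destruct (Ceq_dec (c (S n)) 0) as [Hc|Hc]; [exact Hc|].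
  destruct (Cmult_neq_0 (RtoC (INR (S n))) (c (S n))); try assumption.
  intro E0. apply (not_0_INR (S n)); [lia|]. now apply RtoC_inj.
Qed.

Lemma expansion_unique (a b : nat -> C) (f : C -> C) (n : nat) :
  expansion a f -> expansion b f -> a n = b n.
Proof.
intros Ha Hb.
assert (E : a n + - (1) * b n = 0).
{ apply (expansion_zero (fun n => a n + - (1) * b n) (fun z => f z + - (1) * f z)).
  - apply expansion_plus; [exact Ha | apply expansion_scal, Hb].
  - intros z _. ring. }
replace (a n) with (a n + - (1) * b n + b n) by ring.
rewrite E. ring.
Qed.

(** * Exponential and logarithm *)

Lemma Cexp_plus (x y : C) : Cexp (x + y) = Cexp x * Cexp y.
Proof.
destruct x as [a b], y as [c d].
apply injective_projections; unfold Cexp; simpl;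
  rewrite exp_plus, ?cos_plus, ?sin_plus; ring.
Qed.

Lemma Cexp_0 : Cexp 0 = 1.
Proof.
apply injective_projections; unfold Cexp; simpl;
  rewrite exp_0, ?cos_0, ?sin_0; ring.
Qed.

Lemma Cexp_neq_0 (z : C) : Cexp z <> 0.
Proof.
intro E. apply C1_nz. rewrite <- Cexp_0.
replace (RtoC 0) with (z + - z) by ring.
rewrite Cexp_plus, E. ring.
Qed.

Lemma Cmod_Cexp (z : C) : Cmod (Cexp z) = exp (Re z).
Proof.
unfold Cexp, Cmod. simpl fst. simpl snd.
replace ((exp (Re z) * cos (Im z)) ^ 2 + (exp (Re z) * sin (Im z)) ^ 2)%R
  with (exp (Re z) ^ 2 * (Rsqr (sin (Im z)) + Rsqr (cos (Im z))))%R
  by (unfold Rsqr; ring).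
rewrite sin2_cos2, Rmult_1_r. apply sqrt_pow2. left; apply exp_pos.
Qed.

Lemma Cexp_RtoC_ln (s : R) : (0 < s)%R -> Cexp (RtoC (ln s)) = RtoC s.
Proof.
intro Hs. apply injective_projections; unfold Cexp; simpl;
  rewrite exp_ln, ?cos_0, ?sin_0 by exact Hs; ring.
Qed.

Lemma Cexp_mult_INR (x : C) (n : nat) : Cexp (RtoC (INR n) * x) = Cexp x ^ n.
Proof.
induction n as [|n IH].
- simpl. rewrite <- Cexp_0. f_equal. ring.
- rewrite S_INR, RtoC_plus, Cmult_plus_distr_r, Cexp_plus, IH, Cmult_1_l.
  simpl. ring.
Qed.

Lemma Cexp_Clog (z : C) : z <> 0 -> Cexp (Clog z) = z.
Proof.
intro Hz. apply Cmod_gt_0 in Hz.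
set (m := Cmod z) in *.
assert (Hm : (m ^ 2 = Re z ^ 2 + Im z ^ 2)%R) by apply Cmod2_alt.
assert (Hx : (-1 <= Re z / m <= 1)%R).
{ split; [apply Rle_div_r | apply Rle_div_l]; try exact Hz; nra. }
(* The sine of an arc cosine only recovers |Im z|; the case distinction in [Carg] restores the
   sign. *)
assert (Hsin : (m * sqrt (1 - Rsqr (Re z / m)) = Rabs (Im z))%R).
{ rewrite <- sqrt_Rsqr_abs.
  rewrite <- (sqrt_Rsqr m) at 1 by lra.
  rewrite <- sqrt_mult_alt by apply Rle_0_sqr.
  f_equal. unfold Rsqr. field_simplify; [|lra]. nra. }
apply injective_projections; unfold Cexp, Clog, Carg; fold m; simpl;
  rewrite exp_ln by exact Hz; destruct (Rle_dec 0 (Im z)) as [Hi|Hi];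
  rewrite ?cos_neg, ?sin_neg, ?cos_acos, ?sin_acos by exact Hx.
- unfold Re. field. lra.
- unfold Re. field. lra.
- rewrite Hsin. apply Rabs_pos_eq, Hi.
- rewrite <- Ropp_mult_distr_r, Hsin, Rabs_left by lra. unfold Im. ring.
Qed.

(** The argument is constant on an open ray from the origin, so no multiple of 2 pi i appears. *)
Lemma Clog_ray (s : R) (z : C) :
  (0 < s)%R -> z <> 0 -> Clog (RtoC s * z) = RtoC (ln s) + Clog z.
Proof.
intros Hs Hz. apply Cmod_gt_0 in Hz.
assert (Hm : Cmod (RtoC s * z) = (s * Cmod z)%R)
  by (rewrite Cmod_mult, Cmod_R, Rabs_pos_eq; lra).
assert (HR : Re (RtoC s * z) = (s * Re z)%R) by (unfold Re; simpl; ring).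
assert (HI : Im (RtoC s * z) = (s * Im z)%R) by (unfold Im; simpl; ring).
assert (HC : Carg (RtoC s * z) = Carg z).
{ unfold Carg. rewrite Hm, HR, HI.
  replace (s * Re z / (s * Cmod z))%R with (Re z / Cmod z)%R by (field; lra).
  destruct (Rle_dec 0 (s * Im z)), (Rle_dec 0 (Im z)); try reflexivity; nra. }
unfold Clog. rewrite HC, Hm, ln_mult by assumption.
apply injective_projections; simpl; ring.
Qed.

(** * Complex functions of a real variable *)

Lemma is_derive_C_pair (u v : R -> R) (s du dv : R) :
  is_derive u s du -> is_derive v s dv ->
  is_derive (K := R_AbsRing) (V := C_R_NormedModule) (fun t => (u t, v t)) s (du, dv).
Proof.
intros Hu Hv.
apply (filterdiff_ext_lin (K := R_AbsRing) (U := R_NormedModule)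
  (V := C_R_NormedModule) _ (fun t => (scal t du, scal t dv))).
- apply (filterdiff_comp_2 (K := R_AbsRing) u v (fun x y => (x, y))
    (fun t => scal t du) (fun t => scal t dv) (fun x y => (x, y)) Hu Hv).
  apply (filterdiff_ext_lin _ (fun x => x)); [|now intros []].
  apply (filterdiff_ext (fun x => x)); [now intros []|].
  apply filterdiff_id.
- reflexivity.
Qed.

Lemma is_derive_C_proj (f : R -> C) (s : R) (l : C) :
  is_derive (K := R_AbsRing) (V := C_R_NormedModule) f s l ->
  is_derive (fun t => fst (f t)) s (fst l) /\ is_derive (fun t => snd (f t)) s (snd l).
Proof.
intro H. split.
- apply (filterdiff_comp (K := R_AbsRing) (V := C_R_NormedModule) f fst _ fst H).
  apply filterdiff_linear, is_linear_fst.
- apply (filterdiff_comp (K := R_AbsRing) (V := C_R_NormedModule) f snd _ snd H).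
  apply filterdiff_linear, is_linear_snd.
Qed.

(** The real product rule is applied to the four products of components, and the results are
    reassembled. *)
Lemma is_derive_Cmult_real (f g : R -> C) (s : R) (df dg : C) :
  is_derive (K := R_AbsRing) (V := C_R_NormedModule) f s df ->
  is_derive (K := R_AbsRing) (V := C_R_NormedModule) g s dg ->
  is_derive (K := R_AbsRing) (V := C_R_NormedModule) (fun t => f t * g t) s
    (df * g s + f s * dg).
Proof.
intros Hf Hg.
apply is_derive_C_proj in Hf. apply is_derive_C_proj in Hg.
destruct Hf as [f1 f2], Hg as [g1 g2].
pose proof (fun u v du dv (Hu : is_derive u s du) (Hv : is_derive v s dv) =>
  is_derive_mult (K := R_AbsRing) u v s du dv Hu Hv Rmult_comm) as mul.
assert (H := is_derive_C_pair _ _ s _ _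
  (is_derive_minus _ _ _ _ _ (mul _ _ _ _ f1 g1) (mul _ _ _ _ f2 g2))
  (is_derive_plus _ _ _ _ _ (mul _ _ _ _ f1 g2) (mul _ _ _ _ f2 g1))).
replace (df * g s + f s * dg) with
 ((minus (plus (mult (fst df) (fst (g s))) (mult (fst (f s)) (fst dg)))
    (plus (mult (snd df) (snd (g s))) (mult (snd (f s)) (snd dg))),
  plus (plus (mult (fst df) (snd (g s))) (mult (fst (f s)) (snd dg)))
    (plus (mult (snd df) (fst (g s))) (mult (snd (f s)) (fst dg)))) : C).
- exact H.
- apply injective_projections; unfold minus, plus, opp, mult; simpl; ring.
Qed.

(** This is the power rule for t^c with t > 0 and complex c, the power being written as exp (c ln
    t). *)
Lemma is_derive_Cexp_ln (c : C) (s : R) : (0 < s)%R ->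
  is_derive (K := R_AbsRing) (V := C_R_NormedModule)
    (fun t => Cexp (c * RtoC (ln t))) s (c * Cexp ((c - 1) * RtoC (ln s))).
Proof.
intro Hs.
assert (E : Cexp ((c - 1) * RtoC (ln s)) = Cexp (c * RtoC (ln s)) / RtoC s).
{ rewrite <- (Cexp_RtoC_ln s Hs).
  replace (c * RtoC (ln s)) with ((c - 1) * RtoC (ln s) + RtoC (ln s)) by ring.
  rewrite Cexp_plus. field. apply Cexp_neq_0. }
rewrite E. clear E. destruct c as [a b].
apply (is_derive_ext (K := R_AbsRing) (V := C_R_NormedModule) (fun t =>
  ((exp (a * ln t) * cos (b * ln t))%R, (exp (a * ln t) * sin (b * ln t))%R))).
{ intro t. unfold Cexp. simpl. f_equal; f_equal; f_equal; ring. }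
match goal with |- is_derive _ _ ?d => replace d with
  ((/ s * exp (a * ln s) * (a * cos (b * ln s) - b * sin (b * ln s)))%R,
   (/ s * exp (a * ln s) * (a * sin (b * ln s) + b * cos (b * ln s)))%R) end.
- apply is_derive_C_pair; auto_derive; try ring; repeat split; exact Hs.
- unfold Cexp. simpl.
  replace (a * ln s - b * 0)%R with (a * ln s)%R by ring.
  replace (a * 0 + b * ln s)%R with (b * ln s)%R by ring.
  apply injective_projections; simpl; field; nra.
Qed.

(** * The integral operator *)

Lemma disc_ray (s : R) (z : C) : (0 <= s <= 1)%R -> disc z -> disc (RtoC s * z).
Proof.
intros Hs Hz. unfold disc in *.
rewrite Cmod_mult, Cmod_R, Rabs_pos_eq by lra.
pose proof (Cmod_ge_0 z). nra.
Qed.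

Lemma Re_pos_plus_INR_neq_0 (alpha : C) (n : nat) :
  (0 < Re alpha)%R -> alpha + RtoC (INR n) <> 0.
Proof.
intros Ha E. apply (f_equal Re) in E. unfold Re in *. simpl in E.
pose proof (pos_INR n). lra.
Qed.

(** The denominators stay away from 0: |alpha + n| is at least Re alpha + n, hence at least Re
    alpha. *)
Lemma radius_ge_1_resolvent (alpha : C) (c : nat -> C) :
  (0 < Re alpha)%R -> radius_ge_1 c -> radius_ge_1 (fun n => c n / (alpha + RtoC (INR n))).
Proof.
intro Ha. apply (radius_ge_1_le _ _ (/ Re alpha)). intro n.
rewrite Cmod_div by (apply Re_pos_plus_INR_neq_0, Ha).
rewrite Rmult_comm. apply Rmult_le_compat_l; [apply Cmod_ge_0|].
apply Rinv_le_contravar; [exact Ha|].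
eapply Rle_trans; [|apply re_le_Cmod].
eapply Rle_trans; [|apply Rle_abs].
unfold Re. simpl. pose proof (pos_INR n). lra.
Qed.

(** Comparing coefficients gives h = alpha k + w k'. By the product rule the derivative of s^alpha k
    (s z) is then s^(alpha-1) times the right-hand side at w = s z. *)
Lemma is_derive_ray_primitive (alpha : C) (c : nat -> C) (h k : C -> C) (z : C) (s : R) :
  (0 < Re alpha)%R -> expansion c h ->
  expansion (fun n => c n / (alpha + RtoC (INR n))) k ->
  (0 < s <= 1)%R -> disc z ->
  is_derive (K := R_AbsRing) (V := C_R_NormedModule)
    (fun t => Cexp (alpha * RtoC (ln t)) * k (RtoC t * z)) s
    (Cexp ((alpha - 1) * RtoC (ln s)) * h (RtoC s * z)).
Proof.
intros Ha Hh Hk Hs Hz.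
assert (Hsz : disc (RtoC s * z)) by (apply disc_ray; [lra | exact Hz]).
assert (E : h (RtoC s * z) =
  alpha * k (RtoC s * z) + RtoC s * z * C_derive k (RtoC s * z)).
{ apply (is_pseries_C_unique c (RtoC s * z)); [exact (Hh _ Hsz)|].
  revert Hsz. refine (expansion_ext _ _ _ _ _ (fun w _ => eq_refl)
    (expansion_plus _ _ _ _ (expansion_scal alpha _ _ Hk) (expansion_euler _ _ Hk)) _).
  intro n. simpl. field. apply Re_pos_plus_INR_neq_0, Ha. }
rewrite E.
replace (_ * _) with
  (alpha * Cexp ((alpha - 1) * RtoC (ln s)) * k (RtoC s * z)
   + Cexp (alpha * RtoC (ln s)) * (z * C_derive k (RtoC s * z))).
- apply is_derive_Cmult_real; [apply is_derive_Cexp_ln; lra|].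
  exact (expansion_is_derive_ray _ _ _ z s Hk (expansion_C_derive _ _ Hk) Hsz).
- replace (alpha * RtoC (ln s)) with ((alpha - 1) * RtoC (ln s) + RtoC (ln s)) by ring.
  rewrite Cexp_plus, Cexp_RtoC_ln by lra. ring.
Qed.

(** Near 0 the function [k] is bounded, and |t^alpha| = t^(Re alpha) tends to 0. *)
Lemma filterlim_ray_primitive_0 (alpha : C) (c : nat -> C) (k : C -> C) (z : C) (eps : posreal) :
  (0 < Re alpha)%R -> expansion c k ->
  at_right 0 (fun t => (Cmod (Cexp (alpha * RtoC (ln t)) * k (RtoC t * z)%C) < eps)%R).
Proof.
intros Ha Hk.
pose proof (cond_pos eps) as He.
destruct (expansion_taylor2 c k (C_derive k) (1 / 2) Hk (expansion_C_derive _ _ Hk))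
  as [M HM]; [lra|].
(* This bounds |k| on the disc of radius 1/2, by the Taylor estimate at 0. *)
pose (B := (Cmod (k 0) + Cmod (C_derive k 0) + Rabs M + 1)%R).
assert (HB : (0 < B)%R).
{ unfold B. pose proof (Cmod_ge_0 (k 0)). pose proof (Cmod_ge_0 (C_derive k 0)).
  pose proof (Rabs_pos M). lra. }
assert (Hk' : forall w, (Cmod w <= 1 / 2)%R -> (Cmod (k w) <= B)%R).
{ intros w Hw. pose proof (Cmod_ge_0 w).
  assert (H0 : (Cmod 0 <= 1 / 2)%R) by (rewrite Cmod_0; lra).
  specialize (HM w 0 Hw H0).
  replace (w - 0) with w in HM by ring.
  replace (k w) with (k w - k 0 - w * C_derive k 0 + (k 0 + w * C_derive k 0)) by ring.
  eapply Rle_trans; [apply Cmod_triangle|].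
  pose proof (Cmod_triangle (k 0) (w * C_derive k 0)) as Ht.
  rewrite Cmod_mult in Ht.
  pose proof (Cmod_ge_0 (C_derive k 0)). pose proof (Rle_abs M). pose proof (Rabs_pos M).
  assert (M * Cmod w ^ 2 <= Rabs M)%R.
  { assert (0 <= Cmod w ^ 2 <= 1)%R by (simpl; nra). nra. }
  unfold B. nra. }
(* Below [d1] the point [t z] stays in the disc of radius 1/2; [d2] is the solution t of t^(Re
   alpha) B = eps. *)
pose (d1 := (/ (2 * (Cmod z + 1)))%R).
pose (d2 := exp (ln (eps / B) / Re alpha)).
pose proof (Cmod_ge_0 z) as Hz0.
assert (Hd1 : (0 < d1)%R) by (apply Rinv_0_lt_compat; lra).
assert (Hd2 : (0 < d2)%R) by apply exp_pos.
exists (mkposreal _ (Rmin_pos _ _ Hd1 Hd2)). intros t Ht Ht0.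
change (Rabs (t - 0) < Rmin d1 d2)%R in Ht.
rewrite Rminus_0_r, Rabs_pos_eq in Ht by lra.
assert (Ht1 : (t < d1)%R) by (eapply Rlt_le_trans; [exact Ht | apply Rmin_l]).
assert (Ht2 : (t < d2)%R) by (eapply Rlt_le_trans; [exact Ht | apply Rmin_r]).
rewrite Cmod_mult, Cmod_Cexp.
replace (Re (alpha * RtoC (ln t))) with (Re alpha * ln t)%R
  by (unfold Re; simpl; ring).
apply Rle_lt_trans with (exp (Re alpha * ln t) * B)%R.
- apply Rmult_le_compat_l; [left; apply exp_pos|]. apply Hk'.
  rewrite Cmod_mult, Cmod_R, Rabs_pos_eq by lra.
  apply Rle_trans with (d1 * (Cmod z + 1))%R; [nra|].
  right. unfold d1. field. lra.
- apply Rlt_div_r; [exact HB|].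
  rewrite <- (exp_ln (eps / B)) by (apply Rdiv_lt_0_compat; assumption).
  apply exp_increasing.
  apply ln_increasing in Ht2; [|exact Ht0]. unfold d2 in Ht2. rewrite ln_exp in Ht2.
  apply Rlt_div_r in Ht2; [|exact Ha]. lra.
Qed.

Lemma unit_at_right : at_right 0 (fun t => (0 < t < 1)%R).
Proof.
exists (mkposreal 1 Rlt_0_1). intros t Ht Ht0. split; [exact Ht0|].
change (Rabs (t - 0) < 1)%R in Ht. apply Rabs_def2 in Ht. lra.
Qed.

(** On [t, 1] the fundamental theorem gives G 1 - G t, where G 1 = k z and G t tends to 0 with t. *)
Lemma is_RInt_gen_ray (alpha : C) (c : nat -> C) (h k : C -> C) (z : C) :
  (0 < Re alpha)%R -> expansion c h ->
  expansion (fun n => c n / (alpha + RtoC (INR n))) k -> disc z ->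
  is_RInt_gen (V := C_R_NormedModule)
    (fun s => Cexp ((alpha - 1) * RtoC (ln s)) * h (RtoC s * z))
    (at_right 0) (at_point 1) (k z).
Proof.
intros Ha Hh Hk Hz.
pose (G := fun t => Cexp (alpha * RtoC (ln t)) * k (RtoC t * z)).
assert (G1 : G 1%R = k z).
{ unfold G. rewrite ln_1, Cmult_0_r, Cexp_0, !Cmult_1_l. reflexivity. }
apply filterlimi_locally.
intro eps.
eapply Filter_prod.
- exact (filter_and _ _ unit_at_right (filterlim_ray_primitive_0 alpha _ k z eps Ha Hk)).
- exact (eq_refl 1%R).
- intros t y [Ht Hsmall] <-. simpl fst. simpl snd.
  exists (minus (G 1%R : C_R_NormedModule) (G t)). split.
  + apply (is_RInt_derive (V := C_R_CompleteNormedModule) G).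
    * intros s Hs. rewrite Rmin_left, Rmax_right in Hs by lra.
      apply is_derive_ray_primitive with c; try assumption. lra.
    * intros s Hs. rewrite Rmin_left, Rmax_right in Hs by lra.
      apply (ex_derive_continuous (K := R_AbsRing) (V := C_R_NormedModule)).
      eexists. apply is_derive_Cmult_real; [apply is_derive_Cexp_ln; lra|].
      apply (expansion_is_derive_ray _ _ _ z s Hh (expansion_C_derive _ _ Hh)).
      apply disc_ray; [lra | exact Hz].
  + apply (norm_compat1 (V := C_R_NormedModule)).
    rewrite <- Cmod_norm, G1.
    match goal with |- (Cmod ?u < _)%R => replace u with (- G t) end.
    * rewrite Cmod_opp. exact Hsmall.
    * transitivity (k z - G t - k z); [ring | reflexivity].
Qed.

(* Dividing out [z ^ p] turns the integrand into [s ^ (alpha - 1)] times an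
   analytic function of [s z], so that the exponent has positive real part even
   when that of [alpha - p] has not. *)
Lemma integral_operator_expansion (p : nat) (alpha : C) (A : nat -> C) (f : C -> C) :
  (1 <= p)%nat -> (0 < Re alpha)%R ->
  (forall n, (n < p)%nat -> A n = 0) -> expansion A f ->
  expansion (fun n => alpha / (alpha + RtoC (INR n) - RtoC (INR p)) * A n)
    (integral_operator p alpha f).
Proof.
intros Hp Ha A0 Hf.
(* These are the coefficients of f / z^p. *)
pose (c := fun n => A (n + p)%nat).
assert (Hc : radius_ge_1 c) by (apply radius_ge_1_shift, (expansion_radius _ _ Hf)).
destruct (radius_expansion _ Hc) as [h Hh].
destruct (radius_expansion _ (radius_ge_1_resolvent alpha c Ha Hc)) as [k Hk].
assert (incr : forall (d : nat -> C) (u : C -> C), expansion d u ->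
  expansion (PS_incr_n (K := C_AbsRing) (V := C_NormedModule) d p)
    (fun z => z ^ p * u z)).
{ intros d u Hd z Hz.
  exact (is_pseries_incr_n (K := C_AbsRing) (V := C_NormedModule) d p z _ (Hd z Hz)). }
assert (Efh : forall z, disc z -> f z = z ^ p * h z).
{ intros z Hz. apply (is_pseries_C_unique A z); [exact (Hf z Hz)|].
  revert Hz. refine (expansion_ext _ _ _ _ _ (fun w _ => eq_refl) (incr c h Hh) z).
  intro n. rewrite PS_incr_n_simplify.
  destruct (Compare_dec.le_lt_dec p n) as [Hn|Hn].
  - unfold c. f_equal. lia.
  - symmetry. exact (A0 n Hn). }
refine (expansion_ext _ _ _ _ _ _ (expansion_scal alpha _ _ (incr _ k Hk))).
- intro n. rewrite PS_incr_n_simplify.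
  destruct (Compare_dec.le_lt_dec p n) as [Hn|Hn].
  + unfold c. replace (n - p + p)%nat with n by lia.
    rewrite minus_INR, RtoC_minus by exact Hn.
    unfold Cdiv. replace (alpha + RtoC (INR n) - RtoC (INR p))
      with (alpha + (RtoC (INR n) - RtoC (INR p))) by ring.
    ring.
  + rewrite (A0 n Hn). eq_in C. rewrite (Cmult_0_r (alpha / _)). apply Cmult_0_r.
(* The factor [m] absorbs what does not depend on [s]: it is 0 when z = 0, and z^(alpha-p) z^p
   otherwise. *)
- assert (ray : forall m z, disc z -> is_RInt_gen (V := C_R_NormedModule)
    (fun s => Cexp ((alpha - 1) * RtoC (ln s)) * (m * h (RtoC s * z)))
    (at_right 0) (at_point 1) (m * k z)).
  { intros m z Hz.
    apply (is_RInt_gen_ray alpha (fun n => m * c n) (fun w => m * h w) (fun w => m * k w));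
      try assumption; [exact (expansion_scal m _ _ Hh)|].
    refine (expansion_ext _ _ _ _ _ (fun w _ => eq_refl) (expansion_scal m _ _ Hk)).
    intro n. unfold Cdiv. ring. }
  intros z Hz. unfold integral_operator.
  destruct (Ceq_dec z 0) as [E0|Hz0].
  + subst z.
    rewrite (is_RInt_gen_unique (V := C_R_CompleteNormedModule) _ (0 * k 0)).
    (* Both sides vanish at 0, the right one because z^p does for p at least 1. *)
    * destruct p as [|p]; [lia|]. simpl. ring.
    * refine (is_RInt_gen_ext _ _ _ _ (ray 0 0 disc_0)).
      apply filter_forall. intros [x y] s _. simpl. eq_in C. ring.
  + pose (zeta := Cexp ((alpha - RtoC (INR p)) * Clog z)).
    assert (Hzeta : zeta <> 0) by apply Cexp_neq_0.
    rewrite (is_RInt_gen_unique (V := C_R_CompleteNormedModule) _ (zeta * z ^ p * k z)).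
    * unfold Cpower. fold zeta. field. exact Hzeta.
    * refine (is_RInt_gen_ext _ _ _ _ (ray (zeta * z ^ p) z Hz)).
      apply (Filter_prod _ _ _ (fun x => 0 < x < 1)%R (eq 1%R)); [exact unit_at_right | reflexivity|].
      intros x y Hx <- s Hs. simpl in Hs. rewrite Rmin_left, Rmax_right in Hs by lra.
      rewrite Efh by (apply disc_ray; [lra | exact Hz]).
      unfold Cpower. rewrite Clog_ray by (exact Hz0 || lra).
      rewrite Cpow_mult_l, <- (Cexp_RtoC_ln s), <- Cexp_mult_INR, Cexp_RtoC_ln by lra.
      (* The power of [s] splits as s^(alpha-p-1) s^p, the second factor coming from (s z)^p;
         likewise z^(alpha-p) = z^(alpha-p-1) z, the last factor coming from dt = z ds. *)
      replace ((alpha - 1) * RtoC (ln s)) with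
        ((alpha - RtoC (INR p) - 1) * RtoC (ln s) + RtoC (INR p) * RtoC (ln s)) by ring.
      replace zeta with (Cexp ((alpha - RtoC (INR p) - 1) * Clog z) * z).
      2: { unfold zeta. rewrite <- (Cexp_Clog z Hz0) at 2. rewrite <- Cexp_plus.
           f_equal. ring. }
      rewrite Cmult_plus_distr_l, !Cexp_plus. eq_in C. ring.
Qed.

(** * The operator family *)

(** Since [is_power] inspects its base only on the disc, the two predicates are equal, and [epsilon]
    then makes the same choice. The inhabitation proofs are identified by proof irrelevance. *)
Lemma power_ext (g1 g2 : C -> C) (mu : R) :
  (forall z, disc z -> g1 z = g2 z) -> power g1 mu = power g2 mu.
Proof.
intro E. unfold power.
rewrite (proof_irrelevance _ (inhabits g1) (inhabits g2)).
f_equal. apply functional_extensionality. intro h.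
apply propositional_extensionality. unfold is_power.
split; (intros [[n [Hn Hh]]|[l [Hl [Hl0 Hh]]]];
  [left; exists n; split; [exact Hn|]; intros z Hz; rewrite (Hh z Hz), (E z Hz); reflexivity
  | right; exists l; split; [exact Hl|]; split; [exact Hl0|]; intros z Hz;
    destruct (Hh z Hz) as [H1 H2]; split; [rewrite H1, (E z Hz); reflexivity | exact H2]]).
Qed.

(** Agreement on the disc yields equality of whole functions, because [power] returns the same
    function for both bases. The subordinations can then be rewritten. *)
Lemma Omega_ext (p : nat) (L : C -> (C -> C) -> (C -> C)) (mu nu : R) (a b : C)
    (f g : C -> C) :
  (forall z, disc z -> L (a + 1) f z = L (b + 1) g z) ->
  (forall z, disc z -> L a f z = L b g z) ->
  Omega p L mu nu a f = Omega p L mu nu b g.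
Proof.
intros E1 E0. apply functional_extensionality. intro z. unfold Omega.
rewrite (power_ext (quot p (L (a + 1) f)) (quot p (L (b + 1) g))).
- rewrite (power_ext (quot p (L a f)) (quot p (L b g))); [reflexivity|].
  intros w Hw. unfold quot. rewrite (E0 w Hw). reflexivity.
- intros w Hw. unfold quot. rewrite (E1 w Hw). reflexivity.
Qed.

Lemma class_A_integral_operator (p : nat) (alpha : C) (f : C -> C) :
  (1 <= p)%nat -> (0 < Re alpha)%R -> class_A p f ->
  class_A p (integral_operator p alpha f).
Proof.
intros Hp Ha [_ [A [A0 [Ap Hf]]]].
pose proof (integral_operator_expansion p alpha A f Hp Ha A0 Hf) as HF.
split; [exact (expansion_analytic _ _ HF)|].
eexists. split; [|split; [|exact HF]].
- intros n Hn. simpl. rewrite (A0 n Hn). apply Cmult_0_r.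
- simpl. rewrite Ap. field.
  intro E. apply (Re_pos_plus_INR_neq_0 alpha 0 Ha). simpl.
  etransitivity; [|exact E]. ring.
Qed.

(** The convolution property supplies expansions that may vary with [f]; uniqueness of coefficients
    identifies them with one fixed sequence [b] and the given [A]. *)
Lemma operator_coefficients (p : nat) (D : C -> Prop)
    (L : C -> (C -> C) -> (C -> C)) (alpha : C -> C) (a : C) :
  operator_family p D L alpha -> D a ->
  exists b : nat -> C, forall f A, class_A p f -> expansion A f ->
    expansion (fun n => b n * A n) (L a f).
Proof.
intros HL Da.
destruct (operator_convolution _ _ _ _ HL a Da) as [l [[_ [b [_ [_ Hb]]]] Hl]].
exists b. intros f A Hf HA.
destruct (Hl f Hf) as [b' [A' [Hb' [HA' H]]]].
refine (expansion_ext _ _ _ _ _ (fun z _ => eq_refl) H).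
intro n. rewrite (expansion_unique b' b l n Hb' Hb), (expansion_unique A' A f n HA' HA).
reflexivity.
Qed.

Lemma operator_integral (p : nat) (D : C -> Prop)
    (L : C -> (C -> C) -> (C -> C)) (alpha : C -> C) (a : C) (f : C -> C) (z : C) :
  (1 <= p)%nat -> operator_family p D L alpha -> D a -> D (a + 1) ->
  (0 < Re (alpha a))%R -> class_A p f -> disc z ->
  L a f z = L (a + 1) (integral_operator p (alpha a) f) z.
Proof.
intros Hp HL Da Da1 Ha Hf Hz.
pose proof (class_A_integral_operator p (alpha a) f Hp Ha Hf) as HF.
destruct (operator_coefficients _ _ _ _ a HL Da) as [b Hb].
destruct (operator_coefficients _ _ _ _ (a + 1) HL Da1) as [b1 Hb1].
pose proof Hf as [_ [A [A0 [_ HA]]]].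
pose proof (integral_operator_expansion p (alpha a) A f Hp Ha A0 HA) as HAF.
assert (rec : forall n, RtoC (INR n) * (b n * A n) =
  alpha a * (b1 n * A n) + - (alpha a - RtoC (INR p)) * (b n * A n)).
{ intro n.
  apply (expansion_unique _ (fun n => alpha a * (b1 n * A n)
    + - (alpha a - RtoC (INR p)) * (b n * A n)) _ n (expansion_euler _ _ (Hb f A Hf HA))).
  refine (expansion_ext _ _ _ _ (fun _ => eq_refl) _ (expansion_plus _ _ _ _
    (expansion_scal (alpha a) _ _ (Hb1 f A Hf HA))
    (expansion_scal (- (alpha a - RtoC (INR p))) _ _ (Hb f A Hf HA)))).
  intros w Hw. rewrite (operator_recurrence _ _ _ _ HL a f w Da Da1 Hf Hw).
    ring. }
apply (is_pseries_C_unique (fun n => b n * A n) z); [exact (Hb f A Hf HA z Hz)|].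
revert z Hz. refine (expansion_ext _ _ _ _ _ (fun w _ => eq_refl) (Hb1 _ _ HF HAF)).
(* Below [p] both coefficients vanish because [A n] does. From [p] on, alpha + (n - p) has positive
   real part, so division is legitimate. *)
intro n. destruct (Nat.lt_ge_cases n p) as [Hn|Hn].
{ rewrite (A0 n Hn). ring. }
assert (Hne : alpha a + RtoC (INR n) - RtoC (INR p) <> 0).
{ replace (alpha a + RtoC (INR n) - RtoC (INR p)) with (alpha a + RtoC (INR (n - p))).
  - apply Re_pos_plus_INR_neq_0, Ha.
  - rewrite minus_INR, RtoC_minus by exact Hn. ring. }
transitivity (alpha a * (b1 n * A n) / (alpha a + RtoC (INR n) - RtoC (INR p))).
- field. exact Hne.
- replace (alpha a * (b1 n * A n)) with
    (RtoC (INR n) * (b n * A n) + (alpha a - RtoC (INR p)) * (b n * A n))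
    by (rewrite rec; ring).
  field. exact Hne.
Qed.

Theorem corollary3p3 (p : nat) (D : C -> Prop)
    (L : C -> (C -> C) -> (C -> C)) (alpha : C -> C)
    (mu nu : R) (a : C) (f phi1 phi2 : C -> C) :
  (1 <= p)%nat ->
  operator_family p D L alpha ->
  D a -> D (a + 1) -> D (a + 2) ->
  (forall b c, D b -> D c -> alpha b = alpha c) ->
  (0 < Re (alpha a))%R ->
  ~ (mu = 0%R /\ nu = 0%R) ->
  class_A p f ->
  analytic phi1 -> phi1 0 = 1 ->
  analytic phi2 -> phi2 0 = 1 ->
  let F := integral_operator p (alpha a) f in
  Omega_admissible p L mu nu a f ->
  Omega_admissible p L mu nu (a + 1) F ->
  (subordinate phi1 (Omega p L mu nu a f) /\
   subordinate (Omega p L mu nu a f) phi2)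
  <->
  (subordinate phi1 (Omega p L mu nu (a + 1) F) /\
   subordinate (Omega p L mu nu (a + 1) F) phi2).
Proof.
intros Hp HL Da Da1 Da2 Halpha Ha _ Hf _ _ _ _ F _ _.
replace (a + 2) with (a + 1 + 1) in Da2 by ring.
rewrite (Omega_ext p L mu nu a (a + 1) f F); [reflexivity| |].
(* The operator identity is used at [a + 1]; [F] is the right integral there because [alpha] takes
   the same value at [a] and [a + 1]. *)
- intros z Hz. unfold F. rewrite (Halpha a (a + 1) Da Da1) in *.
  exact (operator_integral p D L alpha (a + 1) f z Hp HL Da1 Da2 Ha Hf Hz).
- intros z Hz. exact (operator_integral p D L alpha a f z Hp HL Da Da1 Ha Hf Hz).
Qed.
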